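(* Let $k\in\mathbb{Z}_{>0}$ and $\ell\in\mathbb{Z}$. Then for all $u\in\mathbb{C}$, $$\mathcal{T}_{k+1,\ell}(u)\,\mathcal{T}_{k-1,\ell}(u)=2\left(u\,\mathcal{T}_{k,\ell}(u)\,\mathcal{T}_{k,\ell}''(u)+\mathcal{T}_{k,\ell}(u)\,\mathcal{T}_{k,\ell}'(u)-u\left(\mathcal{T}_{k,\ell}'(u)\right)^2\right),$$ where primes denote derivatives with respect to $u$.
   Context: For $m\in\mathbb{Z}$ and $u\in\mathbb{C}$ let $$g_m(u)=\frac{1}{2\pi i}\oint_{|w|=1}\frac{e^{w+u/w^2}}{w^{m+1}}\,dw$$ (circle traversed once counterclockwise). For integers $k\ge 0$, $\ell\in\mathbb{Z}$ and $u\in\mathbb{C}$ let $$\mathcal{T}_{k,\ell}(u):=\det\big(g_{2i-j+\ell}(u)\big)_{1\le i,j\le k},$$ where $i$ is the row index and $j$ the column index; the empty determinant is $1$, so $\mathcal{T}_{0,\ell}(u)=1$. *)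

(* Defs.v *)
From HB Require Import structures.
From mathcomp Require Import all_boot all_order all_algebra.
From mathcomp Require Import complex.
From mathcomp Require Import all_classical all_reals all_analysis.

Set Implicit Arguments.
Unset Strict Implicit.
Unset Printing Implicit Defensive.

Import Order.TTheory GRing.Theory Num.Theory.
Import numFieldNormedType.Exports.

Local Open Scope ring_scope.
Local Open Scope complex_scope.

Definition cexp (R : realType) (z : R[i]) : R[i] :=
  (expR (complex.Re z))%:C * (cos (complex.Im z) +i* sin (complex.Im z)).

Definition cintegral (R : realType) (a b : R) (F : R -> R[i]) : R[i] :=
  (\int[lebesgue_measure]_(t in `[a, b]) complex.Re (F t))
  +i* (\int[lebesgue_measure]_(t in `[a, b]) complex.Im (F t)).

(* Parametrisation w = e^{it}, 0 <= t <= 2 pi, dw = i e^{it} dt. *)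
Definition unit_circle_integral (R : realType) (f : R[i] -> R[i]) : R[i] :=
  cintegral 0 (2 * pi)
    (fun t => f (cexp ('i%C * t%:C)) * ('i%C * cexp ('i%C * t%:C))).

Definition g_ (R : realType) (m : int) (u : R[i]) : R[i] :=
  (2 * pi%:C * 'i%C)^-1 *
  unit_circle_integral (fun w => cexp (w + u / w ^+ 2) / w ^ (m + 1)).

(* Rows and columns are numbered from 1 in g_{2i-j+l}, hence i.+1 and j.+1. *)
Definition calT (R : realType) (k : nat) (l : int) (u : R[i]) : R[i] :=
  \det (\matrix_(i < k, j < k) g_ (2 * i.+1%:Z - j.+1%:Z + l) u).

(* R[i]^o carries the structure of R[i] as a normed module over itself, so the
   limit of difference quotients is taken along complex increments. *)
Definition cderive (R : realType) (f : R[i] -> R[i]) : R[i] -> R[i] :=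
  derive1 (f : R[i]^o -> R[i]^o).

(* Main.v *)
(** Differentiating the contour integral gives [g_m' = g_(m+2)], and integrating
    the total derivative of [e^(w + u/w^2) w^(-m)] over the circle gives
    [g_(m-1) = 2 u g_(m+2) + m g_m].  By the first relation each row of the
    determinant [T_k] is the derivative of the row above, so differentiating such
    a determinant only replaces its last row by the next one.  Let [S] be [T_k]
    with its last column replaced by the next one.  The Desnanot-Jacobi identity
    reads [T_(k+1) T_(k-1) = T_k S' - S T_k'], while the second relation, summed
    against the cofactors, yields [S = 2 u T_k' + c T_k] with [c] constant;
    substituting gives the theorem, with no case distinction at [u = 0]. *)

Require Import Defs.
From HB Require Import structures.
From mathcomp Require Import all_boot all_order all_algebra.
From mathcomp Require Import perm complex.
From mathcomp Require Import all_classical all_reals all_analysis.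
From mathcomp Require Import ring lra zify.
Import Order.TTheory GRing.Theory Num.Theory.
Import numFieldNormedType.Exports.
Local Open Scope ring_scope.

(** * Determinants of doubly indexed families *)

(** Indices are plain naturals, so entries beyond the size remain available. On the indices up to
    [n], [bump n] changes only the last one, sending [n] to [n.+1]; elsewhere it encodes the
    deletion of a row or column. *)
Definition mx_of {R : comNzRingType} (n : nat) (a : nat -> nat -> R) : 'M[R]_n :=
  \matrix_(i, j) a i j.

Lemma det_mx22 {R : comNzRingType} (A : 'M[R]_2) :
  \det A = A 0 0 * A 1 1 - A 0 1 * A 1 0.
Proof.
rewrite (expand_det_row _ 0) !big_ord_recl big_ord0 /= /cofactor !det_mx11 !mxE /=.
rewrite expr0 mul1r expr1 mulN1r mulrN addr0.
by congr (A _ _ * A _ _ - A _ _ * A _ _); apply/val_inj.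
Qed.

Lemma tr_mx_of {R : comNzRingType} n (a : nat -> nat -> R) :
  (mx_of n a)^T = mx_of n (fun i j => a j i).
Proof. by apply/matrixP => i j; rewrite !mxE. Qed.

Lemma cofactor_mx_of {R : comNzRingType} n (a : nat -> nat -> R) (i j : 'I_n.+1) :
  cofactor (mx_of n.+1 a) i j =
  (-1) ^+ (i + j) * \det (mx_of n (fun p q => a (bump i p) (bump j q))).
Proof.
rewrite /cofactor; congr (_ * \det _).
by apply/matrixP => p q; rewrite !mxE.
Qed.

(* [x] is the identity matrix with its last two columns replaced by those of
   [\adj A]: take determinants in [A *m x] and cancel [\det A]. *)
Lemma desnanot_jacobi_reg {R : idomainType} n (a : nat -> nat -> R) :
  \det (mx_of n.+2 a) != 0 ->
  \det (mx_of n.+2 a) * \det (mx_of n a) =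
  \det (mx_of n.+1 a) * \det (mx_of n.+1 (fun i j => a (bump n i) (bump n j)))
  - \det (mx_of n.+1 (fun i j => a i (bump n j)))
    * \det (mx_of n.+1 (fun i j => a (bump n i) j)).
Proof.
set A := mx_of n.+2 a => dA0.
pose p0 : 'I_n.+2 := inord n; pose p1 : 'I_n.+2 := ord_max.
pose x i j : R := if (j < n)%N then (i == j)%:R else (\adj A) (inord i) (inord j).
(* Expected product: the first [n] columns of [A], then [\det A] times the last two unit vectors,
   since [A *m \adj A] is scalar. *)
pose y i j : R := if (j < n)%N then a i j else (\det A) *+ (i == j).
have AX : A *m mx_of n.+2 x = mx_of n.+2 y.
  apply/matrixP => i j; rewrite !mxE /x /y.
  have [jn|jn] := boolP (j < n)%N.
    rewrite (bigD1 j) //= big1 ?addr0; first by rewrite !mxE jn eqxx mulr1.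
    by move=> k kj; rewrite !mxE jn -[_ == _ :> nat]/(k == j) (negbTE kj) mulr0.
  have /matrixP/(_ i j) := mul_mx_adj A; rewrite !mxE => <-.
  apply: eq_bigr => k _.
  by rewrite [mx_of _ x _ _]mxE /x (negbTE jn) !inord_val.
(* Block upper triangular with an identity block, so only the lower right 2 by 2 minor of the
   adjugate remains. *)
have detX : \det (mx_of n.+2 x) =
    (\adj A) p0 p0 * (\adj A) p1 p1 - (\adj A) p0 p1 * (\adj A) p1 p0.
  have -> : \det (mx_of n.+2 x) = \det (mx_of (n + 2) x) by rewrite addn2.
  have i0 : inord (n + 0) = p0 by rewrite addn0.
  have i1 : inord (n + 1) = p1 by apply/val_inj; rewrite addn1 /= inordK.
  rewrite -[mx_of _ _]submxK.
  have -> : dlsubmx (mx_of (n + 2) x) = 0.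
    apply/matrixP => i j; rewrite !mxE /x /= ltn_ord.
    by rewrite gtn_eqF // ltn_addr.
  have -> : ulsubmx (mx_of (n + 2) x) = 1%:M.
    by apply/matrixP => i j; rewrite !mxE /x /= ltn_ord.
  rewrite det_ublock det1 mul1r det_mx22; set d := RHS.
  by rewrite !mxE /x /= -!ltn_subRL !subnn !ltn0 modn_small // i0 i1.
(* Block lower triangular; the scalar block of size 2 gives the square of [\det A]. *)
have detY : \det (mx_of n.+2 y) = \det (mx_of n a) * \det A ^+ 2.
  have -> : \det (mx_of n.+2 y) = \det (mx_of (n + 2) y) by rewrite addn2.
  rewrite -[mx_of _ _]submxK.
  have -> : ursubmx (mx_of (n + 2) y) = 0.
    apply/matrixP => i j; rewrite !mxE /y /= -ltn_subRL subnn ltn0.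
    by rewrite ltn_eqF // ltn_addr.
  have -> : drsubmx (mx_of (n + 2) y) = (\det A)%:M.
    apply/matrixP => i j; rewrite !mxE /y /= -ltn_subRL subnn ltn0.
    by rewrite eqn_add2l.
  rewrite det_lblock det_scalar; congr (\det _ * _).
  by apply/matrixP => i j; rewrite !mxE /y /= ltn_ord.
have /(congr1 determinant) := AX; rewrite det_mulmx detX detY.
have bumpn1 (i : 'I_n.+1) : bump n.+1 i = i by rewrite /bump leqNgt ltn_ord.
have e00 : (\adj A) p0 p0 = \det (mx_of n.+1 (fun i j => a (bump n i) (bump n j))).
  by rewrite mxE cofactor_mx_of inordK // addnn -signr_odd odd_double mul1r.
have e11 : (\adj A) p1 p1 = \det (mx_of n.+1 a).
  rewrite mxE cofactor_mx_of addnn -signr_odd odd_double mul1r.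
  by congr (\det _); apply/matrixP => i j; rewrite !mxE /= !bumpn1.
have e01 : (\adj A) p0 p1 = - \det (mx_of n.+1 (fun i j => a i (bump n j))).
  rewrite mxE cofactor_mx_of inordK //= addSn addnn -signr_odd /= odd_double mulN1r.
  by congr (- \det _); apply/matrixP => i j; rewrite !mxE /= bumpn1.
have e10 : (\adj A) p1 p0 = - \det (mx_of n.+1 (fun i j => a (bump n i) j)).
  rewrite mxE cofactor_mx_of inordK //= addnS addnn -signr_odd /= odd_double mulN1r.
  by congr (- \det _); apply/matrixP => i j; rewrite !mxE /= bumpn1.
rewrite e00 e11 e01 e10 => E; apply: (mulfI dA0).
by rewrite mulrA -expr2 mulrC -E mulrNN [\det (mx_of n.+1 a) * _]mulrC.
Qed.

(* The determinant of ['X + a] is a monic polynomial, so the regular case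
   applies to it over [{poly R}]; then evaluate at [0]. *)
Lemma desnanot_jacobi {R : idomainType} n (a : nat -> nat -> R) :
  \det (mx_of n.+2 a) * \det (mx_of n a) =
  \det (mx_of n.+1 a) * \det (mx_of n.+1 (fun i j => a (bump n i) (bump n j)))
  - \det (mx_of n.+1 (fun i j => a i (bump n j)))
    * \det (mx_of n.+1 (fun i j => a (bump n i) j)).
Proof.
pose b i j : {poly R} := 'X *+ (i == j) + (a i j)%:P.
have b0 : \det (mx_of n.+2 b) != 0.
  have -> : mx_of n.+2 b = char_poly_mx (- mx_of n.+2 a).
    by apply/matrixP => i j; rewrite !mxE polyCN opprK.
  by rewrite monic_neq0 // char_poly_monic.
(* Evaluation at 0 is a ring morphism, so it commutes with determinants; [r] and [c] cover all the
   minors involved. *)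
have ev m (r c : nat -> nat) : (\det (mx_of m (fun i j => b (r i) (c j)))).[0] =
    \det (mx_of m (fun i j => a (r i) (c j))).
  rewrite -horner_evalE -det_map_mx; congr (\det _); apply/matrixP => i j.
  by rewrite !mxE /= horner_evalE !hornerE hornerMn hornerX mul0rn add0r.
have /(congr1 (horner^~ 0)) := desnanot_jacobi_reg n b b0.
by rewrite hornerD hornerN !hornerM (ev _ id id) (ev _ id id) !(ev _ id) !ev.
Qed.

(** * Determinants with one row or column replaced *)

Lemma sum_det_repl_row {R : comNzRingType} n (A B : 'M[R]_n) :
  \sum_i \det (\matrix_(p, q) (if p == i then B p q else A p q)) =
  \sum_i \sum_j B i j * cofactor A i j.
Proof.
apply: eq_bigr => i _; rewrite (expand_det_row _ i); apply: eq_bigr => j _.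
rewrite mxE eqxx; congr (_ * (_ * \det _)); apply/matrixP => p q.
by rewrite !mxE eq_sym (negbTE (neq_lift _ _)).
Qed.

(** Expanding along the replaced column leaves the cofactors of [A] unchanged. The double sum is the
    one obtained for rows, which lets row and column replacements be compared. *)
Lemma sum_det_repl_col {R : comNzRingType} n (A B : 'M[R]_n) :
  \sum_j \det (\matrix_(p, q) (if q == j then B p q else A p q)) =
  \sum_i \sum_j B i j * cofactor A i j.
Proof.
rewrite [RHS]exchange_big /=; apply: eq_bigr => j _.
rewrite (expand_det_col _ j); apply: eq_bigr => i _.
rewrite mxE eqxx; congr (_ * (_ * \det _)); apply/matrixP => p q.
by rewrite !mxE eq_sym (negbTE (neq_lift _ _)).
Qed.

(** Replacing a row other than the last by its successor creates two equal rows, so that term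
    vanishes. *)
Lemma sum_det_succ_row {R : comNzRingType} n (a : nat -> nat -> R) :
  \sum_(i < n.+1) \det (\matrix_(p < n.+1, q < n.+1) a (if p == i then p.+1 else p) q)
  = \det (mx_of n.+1 (fun p q => a (bump n p) q)).
Proof.
rewrite big_ord_recr big1 /= => [|i _]; rewrite ?add0r.
  congr (\det _); apply/matrixP => p q; rewrite !mxE /bump; congr (a _ _).
  rewrite -val_eqE /=; have := ltn_ord p; case: (eqVneq (p : nat) n); lia.
pose i' : 'I_n.+1 := lift ord0 i.
apply: (@determinant_alternate _ _ _ (widen_ord (leqnSn n) i) i') => [|q].
  by rewrite -val_eqE /= /bump /=; lia.
by rewrite !mxE eqxx -val_eqE /= /bump /= add1n gtn_eqF.
Qed.

Lemma sum_det_succ_col {R : comNzRingType} n (a : nat -> nat -> R) :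
  \sum_(j < n.+1) \det (\matrix_(p < n.+1, q < n.+1) a p (if q == j then q.+1 else q))
  = \det (mx_of n.+1 (fun p q => a p (bump n q))).
Proof.
rewrite -[RHS]det_tr tr_mx_of -(sum_det_succ_row _ (fun p q => a q p)).
apply: eq_bigr => j _; rewrite -det_tr; congr (\det _).
by apply/matrixP => p q; rewrite !mxE.
Qed.

(* Both sides are [\sum_(i, j) a i j.+1 * cofactor i j]: in the sum of the
   determinants with one row (or column) replaced by its successor, only the
   replacement of the last one survives. *)
Lemma det_last_col {R : comNzRingType} n (a : nat -> nat -> R) (v : R) (r c : nat -> R) :
  (forall i j, a i j.+1 = v * a i.+1 j + (r i + c j) * a i j) ->
  \det (mx_of n.+1 (fun i j => a i (bump n j))) =
  v * \det (mx_of n.+1 (fun i j => a (bump n i) j))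
  + (\sum_(i < n.+1) r i + \sum_(j < n.+1) c j) * \det (mx_of n.+1 a).
Proof.
move=> aE; set A := mx_of n.+1 a.
rewrite -sum_det_succ_col -sum_det_succ_row.
transitivity (\sum_i \sum_j (\matrix_(p, q) a p q.+1) i j * cofactor A i j).
  rewrite -sum_det_repl_col; apply: eq_bigr => j _; congr (\det _).
  by apply/matrixP => p q; rewrite !mxE; case: ifP.
under eq_bigr do under eq_bigr do rewrite mxE aE mulrDl -mulrA.
rewrite mulrDl; under eq_bigr do rewrite big_split /= -mulr_sumr.
rewrite big_split /= -mulr_sumr; congr (_ * _ + _).
  transitivity (\sum_i \sum_j (\matrix_(p, q) a p.+1 q) i j * cofactor A i j).
    by do 2!apply: eq_bigr => ? _; rewrite mxE.
  rewrite -sum_det_repl_row; apply: eq_bigr => i _; congr (\det _).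
  by apply/matrixP => p q; rewrite !mxE; case: ifP.
rewrite !mulr_suml.
(* The weight [r i] is constant along row [i] and [c j] along column [j]: Laplace expansion by rows
   for the first and by columns for the second gives [\det A] each time. *)
transitivity (\sum_(i < n.+1) \sum_(j < n.+1) (r i * (A i j * cofactor A i j)
                             + c j * (A i j * cofactor A i j))).
  by do 2!apply: eq_bigr => ? _; rewrite mxE; ring.
under eq_bigr do rewrite big_split /=.
rewrite big_split /=; congr (_ + _).
  by apply: eq_bigr => i _; rewrite -mulr_sumr -expand_det_row.
rewrite exchange_big /=; apply: eq_bigr => j _.
by rewrite -mulr_sumr -expand_det_col.
Qed.

(** * The complex exponential along curves *)

Local Open Scope complex_scope.

Lemma Re_cM {R : realType} (x y : R[i]) :
  complex.Re (x * y) = complex.Re x * complex.Re y - complex.Im x * complex.Im y.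
Proof. by case: x => a b; case: y. Qed.

Lemma Im_cM {R : realType} (x y : R[i]) :
  complex.Im (x * y) = complex.Re x * complex.Im y + complex.Im x * complex.Re y.
Proof. by case: x => a b; case: y. Qed.

Lemma Re_cD {R : realType} (x y : R[i]) :
  complex.Re (x + y) = complex.Re x + complex.Re y.
Proof. by case: x => a b; case: y. Qed.

Lemma Im_cD {R : realType} (x y : R[i]) :
  complex.Im (x + y) = complex.Im x + complex.Im y.
Proof. by case: x => a b; case: y. Qed.

Lemma Re_cN {R : realType} (x : R[i]) : complex.Re (- x) = - complex.Re x.
Proof. by case: x. Qed.

Lemma Im_cN {R : realType} (x : R[i]) : complex.Im (- x) = - complex.Im x.
Proof. by case: x. Qed.

Definition cReImE := (@Re_cM, @Im_cM, @Re_cD, @Im_cD, @Re_cN, @Im_cN).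

Lemma complex_ext {R : realType} (x y : R[i]) :
  complex.Re x = complex.Re y -> complex.Im x = complex.Im y -> x = y.
Proof. by case: x => a b; case: y => c d /= -> ->. Qed.

Lemma cexpD {R : realType} (x y : R[i]) : cexp (x + y) = cexp x * cexp y.
Proof.
by apply: complex_ext; rewrite /cexp !cReImE /= expRD ?cosD ?sinD; ring.
Qed.

Lemma cexp0 {R : realType} : cexp (0 : R[i]) = 1.
Proof. by apply: complex_ext; rewrite /cexp !cReImE /= expR0 cos0 sin0; ring. Qed.

Lemma cexp_neq0 {R : realType} (x : R[i]) : cexp x != 0.
Proof.
apply/eqP => x0; have /eqP := @cexp0 R.
by rewrite -(subrr x) cexpD x0 mul0r eq_sym oner_eq0.
Qed.

Lemma cexpN {R : realType} (x : R[i]) : cexp (- x) = (cexp x)^-1.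
Proof.
apply: (mulIf (cexp_neq0 x)).
by rewrite -cexpD addNr cexp0 mulVf // cexp_neq0.
Qed.

Lemma cexpMn {R : realType} (x : R[i]) n : cexp (x *+ n) = cexp x ^+ n.
Proof. by elim: n => [|n IH]; rewrite ?cexp0 // mulrS exprS cexpD IH. Qed.

Lemma cexpMz {R : realType} (x : R[i]) (m : int) : cexp (x *~ m) = cexp x ^ m.
Proof.
case: m => n; rewrite ?cexpMn //.
by rewrite NegzE mulrNz cexpN cexpMn exprnN.
Qed.

Lemma normc_cexp {R : realType} (x : R[i]) : `|cexp x| = (expR (complex.Re x))%:C.
Proof.
rewrite normc_def /cexp !cReImE /=; congr (_%:C).
rewrite !mul0r subr0 addr0 !exprMn -mulrDr cos2Dsin2 mulr1.
by rewrite sqrtr_sqr ger0_norm // expR_ge0.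
Qed.

(** Componentwise, so that real calculus applies to the real and imaginary parts separately. *)
Definition curve_derive {R : realType} (F dF : R -> R[i]) := forall t : R,
  is_derive t 1 (fun s => complex.Re (F s)) (complex.Re (dF t)) /\
  is_derive t 1 (fun s => complex.Im (F s)) (complex.Im (dF t)).

Definition curve_continuous {R : realType} (F : R -> R[i]) :=
  continuous (fun t => complex.Re (F t)) /\ continuous (fun t => complex.Im (F t)).

Lemma curve_deriveW {R : realType} (F dF dG : R -> R[i]) :
  dF =1 dG -> curve_derive F dF -> curve_derive F dG.
Proof. by move=> e h t; rewrite -e. Qed.

Lemma curve_derive_continuous {R : realType} (F dF : R -> R[i]) :
  curve_derive F dF -> curve_continuous F.
Proof.
by move=> h; split => t; case: (h t) => h1 h2;
  apply/differentiable_continuous/derivable1_diffP.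
Qed.

Lemma curve_derive_lin {R : realType} (c : R[i]) :
  curve_derive (fun t => c * t%:C) (fun=> c).
Proof.
have lin (a : R) (t : R) : is_derive t 1 (fun s : R => a * s) a.
  have h : is_derive t 1 (a \*: (id : R -> R)) (a *: 1) by exact: is_deriveZ.
  by apply: is_derive_eq; rewrite /GRing.scale /= mulr1.
move=> t; split.
  by under eq_fun do rewrite Re_cM /= mulr0 subr0; exact: lin.
by under eq_fun do rewrite Im_cM /= mulr0 add0r; exact: lin.
Qed.

Lemma curve_deriveD {R : realType} (F G dF dG : R -> R[i]) :
  curve_derive F dF -> curve_derive G dG ->
  curve_derive (fun t => F t + G t) (fun t => dF t + dG t).
Proof.
move=> hF hG t; have [F1 F2] := hF t; have [G1 G2] := hG t.
split; under eq_fun do rewrite !cReImE; rewrite !cReImE; exact: is_deriveD.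
Qed.

Lemma curve_deriveZ {R : realType} (c : R[i]) (F dF : R -> R[i]) :
  curve_derive F dF -> curve_derive (fun t => c * F t) (fun t => c * dF t).
Proof.
move=> hF t; have [F1 F2] := hF t.
split; under eq_fun do rewrite !cReImE; rewrite !cReImE.
  by apply: is_deriveB; exact: is_deriveZ.
by apply: is_deriveD; exact: is_deriveZ.
Qed.

Lemma curve_derive_cexp {R : realType} (F dF : R -> R[i]) :
  curve_derive F dF -> curve_derive (fun t => cexp (F t)) (fun t => dF t * cexp (F t)).
Proof.
move=> hF t; have [F1 F2] := hF t.
have he : is_derive t 1 (fun s => expR (complex.Re (F s)))
    (expR (complex.Re (F t)) * complex.Re (dF t)).
  exact: is_derive1_comp.
have hc : is_derive t 1 (fun s => cos (complex.Im (F s)))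
    (- sin (complex.Im (F t)) * complex.Im (dF t)).
  exact: is_derive1_comp.
have hs : is_derive t 1 (fun s => sin (complex.Im (F s)))
    (cos (complex.Im (F t)) * complex.Im (dF t)).
  exact: is_derive1_comp.
rewrite /cexp; split; under eq_fun do rewrite !cReImE /= mul0r ?subr0 ?addr0.
  apply: (@is_derive_eq _ _ _ _ _ _ _ _ (is_deriveM he hc)).
  by rewrite !cReImE /= /GRing.scale /=; ring.
apply: (@is_derive_eq _ _ _ _ _ _ _ _ (is_deriveM he hs)).
by rewrite !cReImE /= /GRing.scale /=; ring.
Qed.

(** * Integration of complex valued functions *)

Lemma curve_continuousD {R : realType} (F G : R -> R[i]) :
  curve_continuous F -> curve_continuous G -> curve_continuous (fun t => F t + G t).
Proof.
move=> [F1 F2] [G1 G2]; split => t; under eq_fun do rewrite !cReImE.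
  by apply: cvgD; [exact: F1|exact: G1].
by apply: cvgD; [exact: F2|exact: G2].
Qed.

Lemma curve_continuousZ {R : realType} (c : R[i]) (F : R -> R[i]) :
  curve_continuous F -> curve_continuous (fun t => c * F t).
Proof.
move=> [F1 F2]; split => t; under eq_fun do rewrite !cReImE.
  by apply: cvgB; apply: cvgMr; [exact: F1|exact: F2].
by apply: cvgD; apply: cvgMr; [exact: F2|exact: F1].
Qed.

Lemma continuous_itv_integrable {R : realType} (a b : R) (f : R -> R) :
  continuous f ->
  (@lebesgue_measure R).-integrable `[a, b]%classic (EFin \o f).
Proof.
move=> cf; apply: continuous_compact_integrable; first exact: segment_compact.
exact: continuous_subspaceT.
Qed.

Lemma cintegralD {R : realType} (a b : R) (F G : R -> R[i]) :
  curve_continuous F -> curve_continuous G ->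
  cintegral a b (fun t => F t + G t) = cintegral a b F + cintegral a b G.
Proof.
move=> [F1 F2] [G1 G2]; apply: complex_ext; rewrite !cReImE /=.
  rewrite -RintegralD //; try exact: continuous_itv_integrable.
  by apply: eq_Rintegral => t _; rewrite !cReImE.
rewrite -RintegralD //; try exact: continuous_itv_integrable.
by apply: eq_Rintegral => t _; rewrite !cReImE.
Qed.

Lemma cintegralZ {R : realType} (a b : R) (c : R[i]) (F : R -> R[i]) :
  curve_continuous F ->
  cintegral a b (fun t => c * F t) = c * cintegral a b F.
Proof.
move=> [F1 F2]; have I1 := @continuous_itv_integrable R a b _ F1.
have I2 := @continuous_itv_integrable R a b _ F2.
have J1 (k : R) : (@lebesgue_measure R).-integrable `[a, b]%classic
    (EFin \o (fun t => k * complex.Re (F t))).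
  by apply: continuous_itv_integrable => t; apply: cvgMr; exact: F1.
have J2 (k : R) : (@lebesgue_measure R).-integrable `[a, b]%classic
    (EFin \o (fun t => k * complex.Im (F t))).
  by apply: continuous_itv_integrable => t; apply: cvgMr; exact: F2.
apply: complex_ext; rewrite !cReImE /= -!RintegralZl //.
  by rewrite -RintegralB //; apply: eq_Rintegral => t _; rewrite !cReImE.
by rewrite -RintegralD //; apply: eq_Rintegral => t _; rewrite !cReImE.
Qed.

Lemma eq_cintegral {R : realType} (a b : R) (F G : R -> R[i]) :
  F =1 G -> cintegral a b F = cintegral a b G.
Proof. by move=> FG; rewrite (_ : F = G) //; exact/funext. Qed.

(** Estimates use [Normc.normc], whose values lie in [R], whereas the norm of [R[i]] takes its
    values in [R[i]]. *)
Lemma Re_le_normc {R : realType} (z : R[i]) : `|complex.Re z| <= Normc.normc z.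
Proof. by rewrite -lecR; exact: normc_ge_Re. Qed.

Lemma Im_le_normc {R : realType} (z : R[i]) : `|complex.Im z| <= Normc.normc z.
Proof. by case: z => a b /=; rewrite -sqrtr_sqr ler_wsqrtr // lerDr sqr_ge0. Qed.

Lemma normc_le_ReIm {R : realType} (z : R[i]) :
  Normc.normc z <= `|complex.Re z| + `|complex.Im z|.
Proof.
case: z => a b /=; rewrite -[leRHS]ger0_norm ?addr_ge0 // -sqrtr_sqr.
rewrite ler_wsqrtr // sqrrD !real_normK ?num_real // lerD2r lerDl.
by rewrite mulrn_wge0 // mulr_ge0.
Qed.

(** The factor 2 comes from bounding the real and imaginary parts separately; any constant would do
    for the remainder estimate below. *)
Lemma normc_cintegral_le {R : realType} (a b M : R) (F : R -> R[i]) :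
  a <= b -> curve_continuous F -> (forall t, Normc.normc (F t) <= M) ->
  Normc.normc (cintegral a b F) <= 2 * ((b - a) * M).
Proof.
move=> ab [F1 F2] FM.
have main (f : R -> R) : continuous f -> (forall t, `|f t| <= M) ->
    `|\int[lebesgue_measure]_(t in `[a, b]) f t| <= (b - a) * M.
  move=> cf fM; apply: le_trans.
    by apply: le_normr_Rintegral => //; exact: continuous_itv_integrable.
  apply: le_trans.
    apply: (@le_Rintegral _ _ _ _ _ _ (fun=> M)) => //; last first.
      by apply: continuous_itv_integrable => t; exact: cvg_cst.
    apply: continuous_itv_integrable => t.
    by apply: continuous_comp; [exact: cf|exact: norm_continuous].
  rewrite Rintegral_cst; last exact: measurable_itv.
  have e : fine (@lebesgue_measure R `[a, b]%classic) = b - a.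
    rewrite lebesgue_measure_itv /= lte_fin.
    by case: ltgtP ab => //= ->; rewrite subrr.
  by rewrite [fine _]e mulrC.
apply: le_trans (normc_le_ReIm _) _; rewrite mulr2n mulrDl !mul1r /=.
by apply: lerD; apply: main => // t; apply: le_trans (FM t);
  [exact: Re_le_normc|exact: Im_le_normc].
Qed.

Lemma cintegral_FTC {R : realType} (a b : R) (F dF : R -> R[i]) :
  a < b -> curve_derive F dF -> curve_continuous dF ->
  cintegral a b dF = F b - F a.
Proof.
move=> ab hF [c1 c2].
have main (f df : R -> R) : (forall t : R, is_derive t 1 f (df t)) -> continuous df ->
    \int[lebesgue_measure]_(t in `[a, b]) df t = f b - f a.
  move=> fd cdf; rewrite /Rintegral (@continuous_FTC2 _ df f) //.
  - exact: continuous_subspaceT.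
  - have cf : continuous f.
      by move=> t; apply/differentiable_continuous/derivable1_diffP.
    split => [t _| |]; first by have [] := fd t.
      by apply: cvg_at_right_filter; exact: cf.
    by apply: cvg_at_left_filter; exact: cf.
  - by move=> t _; rewrite derive1E; have [] := fd t.
apply: complex_ext; rewrite !cReImE /=.
  exact: (main _ _ (fun t => (hF t).1) c1).
exact: (main _ _ (fun t => (hF t).2) c2).
Qed.

(** * The functions g *)

(** Two uses of the mean value theorem: the increment of [f] is [df c], and [df c - df 0] is
    [ddf d * c] with [c] at most 1. *)
Lemma taylor1_bound {R : realType} (M : R) (f df ddf : R -> R) :
  (forall t : R, is_derive t 1 f (df t)) ->
  (forall t : R, is_derive t 1 df (ddf t)) ->
  (forall t, 0 <= t <= 1 -> `|ddf t| <= M) ->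
  `|f 1 - f 0 - df 0| <= M.
Proof.
move=> hf hdf bM.
have cont (g dg : R -> R) : (forall t : R, is_derive t 1 g (dg t)) -> continuous g.
  by move=> hg t; apply/differentiable_continuous/derivable1_diffP.
have [|c] := @MVT_segment R f df 0 1 ler01 (fun t _ => hf t).
  exact/continuous_subspaceT/cont.
rewrite in_itv /= => /andP[c0 c1] ->.
have [|d] := @MVT_segment R df ddf 0 c c0 (fun t _ => hdf t).
  exact/continuous_subspaceT/cont.
rewrite in_itv /= => /andP[d0 dc]; rewrite !subr0 mulr1 => ->.
rewrite normrM (ger0_norm c0).
have dM := bM d; rewrite d0 (le_trans dc c1) in dM.
have := dM isT; have := normr_ge0 (ddf d); nra.
Qed.

Lemma normc_cexpE {R : realType} (z : R[i]) :
  Normc.normc (cexp z) = expR (complex.Re z).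
Proof. by have [] := normc_cexp z. Qed.

Lemma normc_ge0 {R : realType} (z : R[i]) : 0 <= Normc.normc z.
Proof. by case: z => a b; exact: sqrtr_ge0. Qed.

(** The real estimate is applied to both components of [cexp (z * s)] for [s] in [0, 1], whose
    second derivative is [z ^+ 2 * cexp (z * s)]. *)
Lemma cexp_taylor1 {R : realType} (z : R[i]) :
  Normc.normc (cexp z - 1 - z) <= 2 * (Normc.normc z ^+ 2 * expR (Normc.normc z)).
Proof.
pose F (s : R) := cexp (z * s%:C).
have d1 : curve_derive F (fun s => z * F s).
  exact/curve_derive_cexp/curve_derive_lin.
have d2 := curve_deriveZ z _ _ d1.
have z0 := normc_ge0 z.
have b (s : R) : 0 <= s <= 1 -> Normc.normc (z * (z * F s)) <=
    Normc.normc z ^+ 2 * expR (Normc.normc z).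
  move=> /andP[s0 s1]; rewrite 2!Normc.normcM /F normc_cexpE mulrA -expr2.
  rewrite ler_wpM2l ?sqr_ge0 // ler_expR Re_cM /= mulr0 subr0.
  have := Re_le_normc z; rewrite ler_norml => /andP[_ ?]; nra.
have F1 : F 1 = cexp z by rewrite /F mulr1.
have F0 : F 0 = 1 by rewrite /F mulr0 cexp0.
apply: le_trans (normc_le_ReIm _) _; rewrite mulr2n mulrDl !mul1r.
have -> : cexp z - 1 - z = F 1 - F 0 - z * F 0 by rewrite F1 F0 mulr1.
rewrite !(Re_cD, Re_cN, Im_cD, Im_cN); apply: lerD.
  apply: (taylor1_bound _ _ _ _ (fun t => (d1 t).1) (fun t => (d2 t).1)) => s s01.
  exact: le_trans (Re_le_normc _) (b s s01).
apply: (taylor1_bound _ _ _ _ (fun t => (d1 t).2) (fun t => (d2 t).2)) => s s01.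
exact: le_trans (Im_le_normc _) (b s s01).
Qed.

(** The power [w ^ k] at [w = e^(it)], written as an exponential so that negative [k] needs no
    separate treatment. *)
Definition circ {R : realType} (k : int) (t : R) : R[i] :=
  cexp ('i%C * (k%:~R)%:C * t%:C).

(** This is [e^(w + u/w^2) w^(-m)] on the circle: [dw = i w dt] absorbs one power of [w], and the
    factor [i] is left out. *)
Definition g_integrand {R : realType} (m : int) (u : R[i]) (t : R) : R[i] :=
  cexp (circ 1 t + u * circ (- 2) t + 'i%C * ((- m)%:~R)%:C * t%:C).

Lemma circD {R : realType} (k l : int) (t : R) : circ (k + l) t = circ k t * circ l t.
Proof. by rewrite /circ -cexpD; congr cexp; rewrite intrD rmorphD; ring. Qed.

Lemma circ_exp {R : realType} k (t : R) : circ k t = cexp ('i%C * t%:C) ^ k.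
Proof.
rewrite /circ -cexpMz -[in RHS]mulrzr; congr cexp.
by rewrite rmorph_int; ring.
Qed.

Lemma circ0 {R : realType} k : circ k (0 : R) = 1.
Proof. by rewrite /circ mulr0 cexp0. Qed.

Lemma circ_2pi {R : realType} k : circ k (2 * pi : R) = 1.
Proof.
rewrite circ_exp (_ : cexp _ = 1); first exact: exp1rz.
apply: complex_ext; rewrite /cexp !cReImE /=.
  by rewrite !(mul0r, mul1r, oppr0, addr0, add0r) expR0 mulr_natl cos2pi mul1r.
by rewrite !(mul0r, mul1r, add0r, addr0) mulr_natl sin2pi mulr0.
Qed.

Lemma normc_circ {R : realType} k (t : R) : Normc.normc (circ k t) = 1.
Proof.
by rewrite normc_cexpE !cReImE /= -[RHS]expR0; congr expR; ring.
Qed.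

Lemma circ_derive {R : realType} k :
  curve_derive (@circ R k) (fun t => 'i%C * (k%:~R)%:C * circ k t).
Proof. exact/curve_derive_cexp/curve_derive_lin. Qed.

Lemma g_integrandE {R : realType} m u (t : R) :
  g_integrand m u t = cexp (circ 1 t + u * circ (- 2) t) * circ (- m) t.
Proof. by rewrite /g_integrand cexpD. Qed.

Lemma g_integrandD {R : realType} (m k : int) u (t : R) :
  g_integrand (m + k) u t = g_integrand m u t * circ (- k) t.
Proof. by rewrite !g_integrandE (opprD m) (circD (- m)) mulrA. Qed.

(** The logarithmic derivative is [i (w - 2 u w^(-2) - m)], and each power of [w] shifts the index
    of the integrand. *)
Lemma g_integrand_derive {R : realType} m (u : R[i]) :
  curve_derive (g_integrand m u) (fun t =>
    'i%C * (g_integrand (m - 1) u t +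
    ((- 2 * u) * g_integrand (m + 2) u t + (- m%:~R)%:C * g_integrand m u t))).
Proof.
have h := curve_deriveD _ _ _ _ (circ_derive 1)
  (curve_deriveZ u _ _ (circ_derive (- 2))).
apply: curve_deriveW (curve_derive_cexp _ _
  (curve_deriveD _ _ _ _ h (curve_derive_lin ('i%C * ((- m)%:~R)%:C)))).
move=> t /=; rewrite -/(g_integrand m u t) !g_integrandD opprK.
by rewrite !rmorphN !rmorph_int; ring.
Qed.

Lemma g_integrand_continuous {R : realType} m (u : R[i]) :
  curve_continuous (g_integrand m u).
Proof. exact/curve_derive_continuous/g_integrand_derive. Qed.

Lemma g_cintegral {R : realType} m (u : R[i]) :
  g_ m u = (2 * pi)^-1%:C * cintegral 0 (2 * pi) (g_integrand m u).
Proof.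
rewrite /g_ /unit_circle_integral.
rewrite (@eq_cintegral _ _ _ _ (fun t => 'i%C * g_integrand m u t)); last first.
  move=> t; rewrite g_integrandE !circ_exp expr1z -!exprnN -[_ ^ (- m)]invr_expz.
  have := cexp_neq0 ('i%C * t%:C); set w := cexp _ => w0.
  rewrite expfzDr // expr1z; have := expfz_neq0 m w0.
  move: (w ^ m) (cexp (w + _)) => v E v0; field.
  by rewrite w0 v0.
rewrite cintegralZ; last exact: g_integrand_continuous.
rewrite mulrA; congr (_ * _); rewrite fmorphV rmorphM /= rmorph_nat.
rewrite invfM mulrVK // unitfE.
by apply/eqP => -[/eqP]; rewrite oner_eq0.
Qed.

Lemma g_recurrence {R : realType} (m : int) (u : R[i]) :
  g_ (m - 1) u = 2 * u * g_ (m + 2) u + m%:~R * g_ m u.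
Proof.
have c k := @g_integrand_continuous R k u.
have pi0 : (0 : R) < 2 * pi by rewrite mulr_gt0 // pi_gt0.
have := cintegral_FTC _ _ _ _ pi0 (g_integrand_derive m u).
have cZ k a : curve_continuous (fun t => a * g_integrand k u t).
  exact: curve_continuousZ.
have cs : curve_continuous (fun t => (- 2 * u) * g_integrand (m + 2) u t +
   (- m%:~R)%:C * g_integrand m u t) by exact: curve_continuousD.
rewrite !cintegralZ; try exact: curve_continuousD.
rewrite !cintegralD // !cintegralZ //.
(* Both endpoints are the point [w = 1], so the boundary term vanishes. *)
rewrite !g_integrandE !circ0 !circ_2pi subrr.
move=> /(_ (curve_continuousZ _ _ (curve_continuousD _ _ (c _) cs)))/eqP.
have i0 : 'i%C != 0 :> R[i] by apply/eqP => -[/eqP]; rewrite oner_eq0.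
rewrite mulf_eq0 (negbTE i0) /= rmorphN rmorph_int !g_cintegral.
set I1 := cintegral _ _ _; set I2 := cintegral _ _ _; set I3 := cintegral _ _ _.
rewrite addr_eq0 => /eqP ->; move: (_^-1%:C) (m%:~R) => c' m'; ring.
Qed.

(** After division by [h], the quadratic remainder is at most [K] times the modulus of [h], which
    tends to 0. *)
Lemma is_derive_quadratic_remainder {R : realType} (f : R[i] -> R[i])
    (u d : R[i]) (K : R) :
  (forall h, Normc.normc h <= 1 ->
    Normc.normc (f (h + u) - f u - h * d) <= K * Normc.normc h ^+ 2) ->
  is_derive (u : R[i]^o) (1 : R[i]^o) (f : R[i]^o -> R[i]^o) d.
Proof.
move=> hf.
have cv : ((fun h : R[i]^o => h^-1 *: (((f : R[i]^o -> R[i]^o) \o shift (u : R[i]^o))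
    (h *: (1 : R[i]^o)) - f u)) @ (0 : R[i]^o)^' --> (d : R[i]^o))%classic.
  apply/cvgrPdist_le => e e0.
  (* The tolerance is a positive element of [R[i]], hence real. *)
  have [r er] : exists r, e = r%:C by apply/complex_realP; exact: gtr0_real.
  rewrite er in e0 *; have {e0} r0 : 0 < r by rewrite -ltcR.
  (* The bound 1 makes the hypothesis applicable; the other one brings the remainder quotient below
     [r], whatever the sign of [K]. *)
  pose del := Num.min 1 (r / (`|K| + 1)).
  have del0 : 0 < del%:C :> R[i].
    by rewrite ltcR lt_min ltr01 divr_gt0 // ltr_wpDl.
  near=> h.
  have h0 : h != 0 by near: h; exact: nbhs_dnbhs_neq.
  have hd : `|h| < del%:C by near: h; exact: dnbhs0_lt.
  have {hd} : Normc.normc h < del by rewrite -ltcR.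
  rewrite lt_min ltr_pdivlMr ?ltr_wpDl // => /andP[h1 hr].
  have hp : 0 < Normc.normc h.
    rewrite lt_neqAle normc_ge0 andbT eq_sym.
    by apply: contra h0 => /eqP/Normc.eq0_normc ->.
  have -> : d - h^-1 *: (((f : R[i]^o -> R[i]^o) \o shift (u : R[i]^o))
      (h *: (1 : R[i]^o)) - f u) = h^-1 * - (f (h + u) - f u - h * d).
    rewrite /= /GRing.scale /= mulr1; field.
    exact: h0.
  change ((Normc.normc (h^-1 * - (f (h + u) - f u - h * d)))%:C <= r%:C).
  rewrite lecR Normc.normcM Normc.normcV normcN ler_pdivrMl //.
  apply: le_trans (hf h (ltW h1)) _; have := ler_norm K; nra.
by apply: DeriveDef; [exact: cvgP cv|exact: cvg_lim cv].
Unshelve. all: by end_near.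
Qed.

(** Differentiation under the integral sign: the remainder is itself an integral, bounded by a
    multiple of the squared modulus of [h] uniformly on the circle. *)
Lemma g_derive {R : realType} (m : int) (u : R[i]) :
  is_derive (u : R[i]^o) (1 : R[i]^o) (g_ m : R[i]^o -> R[i]^o) (g_ (m + 2) u).
Proof.
(* On the circle the exponent [w + u/w^2] has modulus at most [1 + |u|]. *)
pose K := expR (1 + Normc.normc u).
have bG t : Normc.normc (g_integrand m u t) <= K.
  rewrite g_integrandE Normc.normcM normc_circ mulr1 normc_cexpE ler_expR.
  have := Re_le_normc (circ 1 t + u * circ (- 2) t); rewrite ler_norml => /andP[_].
  move=> /le_trans; apply; apply: le_trans (le_normcD _ _) _.
  by rewrite normc_circ Normc.normcM normc_circ mulr1.
have pi0 : (0 : R) <= 2 * pi by rewrite mulr_ge0 // pi_ge0.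
pose c := Normc.normc ((2 * pi)^-1%:C : R[i]).
(* The factors are the prefactor [c], the 2 of the integral bound, the length [2 * pi], the bound
   [K], and the Taylor constant for arguments of modulus at most 1. *)
apply: (@is_derive_quadratic_remainder _ _ _ _
  (c * (2 * (2 * pi * (K * (2 * expR 1)))))) => h h1.
have cG k v := @g_integrand_continuous R k v.
have cZ k (v a : R[i]) : curve_continuous (fun t : R => a * g_integrand k v t).
  exact: curve_continuousZ.
have cs : curve_continuous (fun t => (- 1) * g_integrand m u t
  + (- h) * g_integrand (m + 2) u t) by exact: curve_continuousD.
have -> : g_ m (h + u) - g_ m u - h * g_ (m + 2) u =
    (2 * pi)^-1%:C * cintegral 0 (2 * pi) (fun t => g_integrand m (h + u) t +
      ((- 1) * g_integrand m u t + (- h) * g_integrand (m + 2) u t)).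
  rewrite !cintegralD // !cintegralZ // !g_cintegral.
  move: (_^-1%:C) (cintegral _ _ _) (cintegral _ _ _) (cintegral _ _ _).
  by move=> x1 x2 x3 x4; ring.
rewrite Normc.normcM -/c -[leRHS]mulrA ler_wpM2l ?normc_ge0 //.
rewrite -mulrA; apply: le_trans.
  apply: (@normc_cintegral_le _ _ _ (K * (2 * (Normc.normc h ^+ 2 * expR 1)))) => //.
    exact: curve_continuousD.
  move=> t.
  (* Factoring out the integrand at [u] leaves the first order Taylor remainder of [cexp] at
     [h w^(-2)]. *)
  have -> : g_integrand m (h + u) t +
      (- 1 * g_integrand m u t + - h * g_integrand (m + 2) u t) =
      g_integrand m u t * (cexp (h * circ (- 2) t) - 1 - h * circ (- 2) t).
    rewrite g_integrandD !g_integrandE.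
    rewrite (_ : circ 1 t + (h + u) * circ (- 2) t =
      h * circ (- 2) t + (circ 1 t + u * circ (- 2) t)); last by ring.
    by rewrite (cexpD (h * _)); ring.
  rewrite Normc.normcM ler_pM ?normc_ge0 //; apply: le_trans (cexp_taylor1 _) _.
  rewrite Normc.normcM normc_circ mulr1 ler_wpM2l // ler_wpM2l ?sqr_ge0 //.
  by rewrite ler_expR.
rewrite subr0 le_eqVlt; apply/orP; left; apply/eqP; ring.
Qed.

Local Close Scope complex_scope.

(** * Derivatives of determinants *)

Section derivative_of_determinant.
Variables (K : numFieldType) (x v : K^o).

Lemma is_derive_sum_seq (I : Type) (s : seq I) (f : I -> K^o -> K^o) (df : I -> K^o) :
  (forall i, is_derive x v (f i) (df i)) ->
  is_derive x v (fun y => \sum_(i <- s) f i y) (\sum_(i <- s) df i).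
Proof.
move=> hf; elim: s => [|i s IH].
  by under eq_fun do rewrite big_nil; rewrite big_nil; exact: is_derive_cst.
under eq_fun do rewrite big_cons.
by rewrite big_cons; exact: is_deriveD.
Qed.

Lemma is_derive_prod_ord n (f : 'I_n -> K^o -> K^o) (df : 'I_n -> K^o) :
  (forall i, is_derive x v (f i) (df i)) ->
  is_derive x v (fun y => \prod_i f i y)
    (\sum_i \prod_j (if j == i then df j else f j x)).
Proof.
elim: n f df => [|n IH] f df hf.
  by under eq_fun do rewrite big_ord0; rewrite big_ord0; exact: is_derive_cst.
under eq_fun do rewrite big_ord_recl.
have h := IH (fun i => f (lift ord0 i)) (fun i => df (lift ord0 i)) (fun i => hf _).
apply: (@is_derive_eq _ _ _ _ _ _ _ _ (is_deriveM (hf ord0) h)).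
rewrite big_ord_recl addrC; congr (_ + _).
  by rewrite big_ord_recl eqxx mulrC.
rewrite /GRing.scale /= mulr_sumr; apply: eq_bigr => i _.
by rewrite big_ord_recl (negbTE (neq_lift _ _)).
Qed.

(** The product rule is applied to each permutation term; exchanging the two sums then groups the
    result by the differentiated row. *)
Lemma is_derive_det n (A : K^o -> 'M[K]_n) (dA : 'M[K]_n) :
  (forall i j, is_derive x v (fun y => A y i j : K^o) (dA i j)) ->
  is_derive x v (fun y => \det (A y) : K^o)
    (\sum_i \det (\matrix_(p, q) (if p == i then dA p q else A x p q))).
Proof.
move=> hA; rewrite /determinant exchange_big /=.
apply: is_derive_sum_seq => s.
have h := is_derive_prod_ord _ (fun i y => A y i (s i)) (fun i => dA i (s i))
  (fun i => hA i (s i)).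
apply: (@is_derive_eq _ _ _ _ _ _ _ _ (is_deriveZ ((-1) ^+ s) h)).
rewrite /GRing.scale /= mulr_sumr; apply: eq_bigr => i _; congr (_ * _).
by apply: eq_bigr => j _; rewrite mxE.
Qed.

End derivative_of_determinant.

(** * The entries of the determinants and the bilinear identity *)

Definition g_entry {R : realType} (l : int) (v : R[i]) (i j : nat) : R[i] :=
  g_ (2 * i.+1%:Z - j.+1%:Z + l) v.

(** The next row has its index raised by 2, exactly the shift that differentiation produces. *)
Lemma g_entry_derive {R : realType} l (u : R[i]) i j :
  is_derive (u : R[i]^o) (1 : R[i]^o) (fun v : R[i]^o => g_entry l v i j : R[i]^o)
    (g_entry l u i.+1 j).
Proof.
rewrite /g_entry (_ : 2 * i.+2%:Z - j.+1%:Z + l = 2 * i.+1%:Z - j.+1%:Z + l + 2).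
  exact: g_derive.
lia.
Qed.

(** The next column lowers the index by 1. The coefficient [m] of the recurrence splits into a row
    part and a column part, the form that [det_last_col] requires. *)
Lemma g_entry_recurrence {R : realType} l (u : R[i]) i j :
  g_entry l u i j.+1 = 2 * u * g_entry l u i.+1 j +
    ((2 * i.+1%:Z + l)%:~R + (- j.+1%:Z)%:~R) * g_entry l u i j.
Proof.
rewrite -intrD /g_entry; set m := 2 * i.+1%:Z - j.+1%:Z + l.
have -> : 2 * i.+1%:Z - j.+2%:Z + l = m - 1 by rewrite /m; lia.
have -> : 2 * i.+2%:Z - j.+1%:Z + l = m + 2 by rewrite /m; lia.
have -> : 2 * i.+1%:Z + l + - j.+1%:Z = m by rewrite /m; lia.
exact: g_recurrence.
Qed.

(** The index maps [r] and [c] let one statement serve for the determinant itself and for those with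
    the last row or last column moved on. *)
Lemma det_g_entry_derive {R : realType} n l (r c : nat -> nat) (u : R[i]) :
  is_derive (u : R[i]^o) (1 : R[i]^o)
    (fun v : R[i]^o => \det (mx_of n (fun i j => g_entry l v (r i) (c j))) : R[i]^o)
    (\sum_(k < n) \det (\matrix_(p < n, q < n)
       g_entry l u (if p == k then (r p).+1 else r p) (c q))).
Proof.
have h := @is_derive_det R[i] (u : R[i]^o) (1 : R[i]^o) n
  (fun v => mx_of n (fun i j => g_entry l v (r i) (c j)))
  (\matrix_(p, q) g_entry l u (r p).+1 (c q)).
apply: is_derive_eq.
  by apply: h => i j; under eq_fun do rewrite mxE; rewrite mxE; exact: g_entry_derive.
apply: eq_bigr => k _; congr (\det _); apply/matrixP => p q.
by rewrite !mxE; case: ifP.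
Qed.

Lemma cderive_val {R : realType} (f : R[i] -> R[i]) (u d : R[i]) :
  is_derive (u : R[i]^o) (1 : R[i]^o) (f : R[i]^o -> R[i]^o) d -> cderive f u = d.
Proof. by move=> h; rewrite /cderive derive1E; exact: derive_val. Qed.

Theorem theorem4 (R : realType) (k : nat) (l : int) (hk : (0 < k)%N) (u : R[i]) :
  calT k.+1 l u * calT k.-1 l u =
  2 * (u * calT k l u * cderive (cderive (calT k l)) u
       + calT k l u * cderive (calT k l) u
       - u * cderive (calT k l) u ^+ 2).
Proof.
case: k hk => // n _ /=.
have TE m (v : R[i]) : calT m l v = \det (mx_of m (g_entry l v)) by [].
pose T' (v : R[i]) := \det (mx_of n.+1 (fun i j => g_entry l v (bump n i) j)).
have dT (v : R[i]) : is_derive (v : R[i]^o) (1 : R[i]^o)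
    (calT n.+1 l : R[i]^o -> R[i]^o) (T' v).
  apply: is_derive_eq; first exact: (det_g_entry_derive n.+1 l id id v).
  exact: sum_det_succ_row.
have -> : cderive (calT n.+1 l) = T' by apply/funext => v; exact/cderive_val.
have dT' := det_g_entry_derive n.+1 l (bump n) id u.
(* [T''] stays an unevaluated sum: it occurs on both sides of the final identity. *)
rewrite (cderive_val _ _ _ dT'); set T'' := \sum_k _ in dT' *.
pose S (v : R[i]) := \det (mx_of n.+1 (fun i j => g_entry l v i (bump n j))).
pose c := \sum_(i < n.+1) (2 * i.+1%:Z + l)%:~R + \sum_(j < n.+1) (- j.+1%:Z)%:~R : R[i].
have SE (v : R[i]) : S v = 2 * v * T' v + c * calT n.+1 l v.
  exact: (det_last_col n _ _ _ _ (g_entry_recurrence l v)).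
(* Computed directly, the derivative of [S] moves the last row as well, which gives the lower right
   minor in the Desnanot-Jacobi identity. *)
have dS := det_g_entry_derive n.+1 l id (bump n) u.
rewrite (sum_det_succ_row n (fun p q => g_entry l u p (bump n q))) in dS.
(* The same derivative, now obtained from the relation [SE], in which [c] does not depend on [v]. *)
have dS2 : is_derive (u : R[i]^o) (1 : R[i]^o) (S : R[i]^o -> R[i]^o)
    (2 * T' u + 2 * u * T'' + c * T' u).
  rewrite (funext SE).
  have d2 : is_derive (u : R[i]^o) (1 : R[i]^o) (fun v : R[i]^o => 2 * v : R[i]^o) 2.
    apply: (@is_derive_eq _ _ _ _ _ _ _ _ (is_deriveZ (2 : R[i]) (is_derive_id _ _))).
    exact: mulr1.
  apply: (@is_derive_eq _ _ _ _ _ _ _ _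
    (is_deriveD (is_deriveM d2 dT') (is_deriveZ c (dT u)))).
  by rewrite /GRing.scale /= -/(T' u); ring.
have ES := etrans (esym (cderive_val _ _ _ dS)) (cderive_val _ _ _ dS2).
(* After substitution the two terms in [c] cancel. *)
rewrite !TE (desnanot_jacobi n (g_entry l u)) ES -/(S u) -/(T' u) SE TE; ring.
Qed.
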